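(* For the path $P_n$ of order $n\geq 2$, $$\gamma_{tm}(P_n)=\begin{cases}4\lceil n/7\rceil-3 & \text{if } n\equiv 1 \pmod 7,\\ 4\lceil n/7\rceil-2 & \text{if } n\equiv 2,3,4 \pmod 7,\\ 4\lceil n/7\rceil-1 & \text{if } n\equiv 5 \pmod 7,\\ 4\lceil n/7\rceil & \text{if } n\equiv 0,6 \pmod 7.\end{cases}$$
   Context: $P_n$ is the path with $n$ vertices. A total mixed dominating set of a finite simple graph $G=(V,E)$ with minimum degree at least $1$ is a set $S\subseteq V\cup E$ such that every element of $V\cup E$ (including those in $S$) is adjacent or incident to an element of $S$ (two vertices are adjacent if joined by an edge; two distinct edges are adjacent if they share an endpoint; a vertex and an edge are incident if the vertex is an endpoint of the edge; no element is adjacent or incident to itself). The total mixed domination number $\gamma_{tm}(G)$ is the minimum cardinality of a total mixed dominating set. *)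

(* Defs.v *)
From mathcomp Require Import all_boot.
Set Implicit Arguments.
Unset Strict Implicit.
Unset Printing Implicit Defensive.

Record sgraph := SGraph {
  vertex :> finType;
  adj : rel vertex;
  adj_sym : symmetric adj;
  adj_irrefl : irreflexive adj }.

Definition edges (G : sgraph) : {set {set G}} :=
  [set [set x; y] | x in [set: G], y in [set: G] & adj x y].

(* The disjoint union of the vertices and the edges of [G]. *)
Definition mixed (G : sgraph) : finType := (G + {a : {set G} | a \in edges G})%type.

(* Distinct elements of V ∪ E that are adjacent or incident. *)
Definition mixed_adj (G : sgraph) (x y : mixed G) : bool :=
  match x, y with
  | inl u, inl v => adj u v
  | inr a, inr b => (a != b) && (val a :&: val b != set0)
  | inl v, inr a | inr a, inl v => v \in val a
  end.

Definition total_mixed_dominating (G : sgraph) (S : {set mixed G}) : bool :=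
  [forall x : mixed G, exists y in S, mixed_adj x y].

Definition min_degree_ge1 (G : sgraph) : Prop := forall x : G, exists y : G, adj x y.

(* V ∪ E is the default of the arg min; it is itself total mixed dominating
   when G has no isolated vertex, so the minimum is then a genuine one, as
   [gamma_tmP] states. *)
Definition gamma_tm (G : sgraph) : nat :=
  #|[arg min_(S < [set: mixed G] | total_mixed_dominating S) #|S|]|.

Lemma total_mixed_dominating_setT (G : sgraph) :
  min_degree_ge1 G -> total_mixed_dominating [set: mixed G].
Proof.
move=> deg1; apply/forallP => -[v|[a aE]]; apply/existsP.
  by have [w vw] := deg1 v; exists (inl w); rewrite inE.
have /imset2P[x y _ _ def_a] := aE.
by exists (inl x); rewrite inE /= def_a set21.
Qed.

Lemma gamma_tmP (G : sgraph) : min_degree_ge1 G ->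
  (exists2 S : {set mixed G}, total_mixed_dominating S & #|S| = gamma_tm G) /\
  (forall S : {set mixed G}, total_mixed_dominating S -> gamma_tm G <= #|S|).
Proof.
move=> /total_mixed_dominating_setT domT; rewrite /gamma_tm.
by case: arg_minnP => // S domS minS; split => //; exists S.
Qed.

Definition path_adj (n : nat) : rel 'I_n :=
  fun i j => (i.+1 == j :> nat) || (j.+1 == i :> nat).

Lemma path_adj_sym n : symmetric (@path_adj n).
Proof. by move=> i j; rewrite /path_adj orbC. Qed.

Lemma path_adj_irrefl n : irreflexive (@path_adj n).
Proof. by move=> i; rewrite /path_adj orbb gtn_eqF. Qed.

Definition path_graph (n : nat) : sgraph :=
  SGraph (@path_adj_sym n) (@path_adj_irrefl n).

Lemma path_graph_min_degree_ge1 n : 2 <= n -> min_degree_ge1 (path_graph n).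
Proof.
move=> n_ge2 i; have [lt_in|] := ltnP i.+1 n.
  by exists (Ordinal lt_in); rewrite /= /path_adj eqxx.
case: i => -[|i] lt_in /= le_n; first by rewrite ltnNge le_n in n_ge2.
by exists (Ordinal (ltnW lt_in)); rewrite /= /path_adj /= eqxx orbT.
Qed.

(* Main.v *)
Require Import Defs.
From mathcomp Require Import all_boot all_order all_algebra zify lra.
Set Implicit Arguments.
Unset Strict Implicit.
Unset Printing Implicit Defensive.
Import Order.TTheory GRing.Theory Num.Theory.
Local Open Scope ring_scope.

(** Listed along the path as v_0, e_0, v_1, e_1, ..., v_(n-1), the vertices and
    edges of [P_n] occupy the positions 0, ..., 2n-2, and two of them are
    adjacent or incident exactly when their positions differ by 1 or 2
    ([mixed_adj_pos]). The problem is therefore that of the total domination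
    number of the square of a path with [m = 2n-1] vertices, which turns out to
    be [square_path_gamma m], for [m >= 3].

    Lower bound ([square_path_gamma_le]). To dominate the [d] positions
    starting at [a], with [d >= 3], at least two elements at most [a+4] are
    needed: one dominating [a], and another that dominates the first one, or
    [a+2] if the first one lies before [a]. These two dominate nothing beyond
    [a+6], so the other elements dominate the last [d-7] positions, and
    induction on [d] applies. Since the elements that remain can lie before
    [a+7], the induction has to allow dominating elements outside the interval.

    Upper bound ([square_path_dominated]). Positions 2 and 4 dominate exactly
    0, ..., 6, so two elements suffice for each additional block of seven
    positions; the lengths from 3 to 9 are settled by explicit sets. *)

(** * Total domination in the square of a path *)

Definition near (p q : nat) : bool :=
  [&& p != q, p <= q + 2 & q <= p + 2]%N.

Definition square_path_gamma (d : nat) : nat :=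
  ((d %/ 7).*2 + minn 2 (uphalf (d %% 7)))%N.

(** The truncated subtraction is deliberate: between 3 and 6 positions still
    cost two elements. *)
Lemma square_path_gamma_sub7 d :
  (3 <= d)%N -> square_path_gamma d = (square_path_gamma (d - 7)).+2.
Proof. by rewrite /square_path_gamma; lia. Qed.

(** The bound [a + 4] is what the induction uses: an element at most [a + 4]
    dominates nothing from [a + 7] on, so both can be discarded at the cost of
    only seven positions. *)
Lemma two_early_dominators d a (s : seq nat) :
  (3 <= d)%N -> (forall p, a <= p < a + d -> has (near p) s)%N ->
  exists x y, [/\ x \in s, y \in s, x != y, x <= a + 4 & y <= a + 4]%N.
Proof.
move=> d3 dom.
have /hasP[x xs ax] : has (near a) s by apply: dom; lia.
have [xa|ax'] := ltnP x a.
  have /hasP[y ys ay] : has (near (a + 2)) s by apply: dom; lia.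
  by exists x, y; move: ax ay; rewrite /near => ax ay; split=> //; lia.
have /hasP[y ys ay] : has (near x) s.
  by apply: dom; move: ax; rewrite /near; lia.
by exists x, y; move: ax ay; rewrite /near => ax ay; split=> //; lia.
Qed.

Lemma square_path_gamma_le d a (s : seq nat) :
  (forall p, a <= p < a + d -> has (near p) s)%N ->
  (square_path_gamma d <= size s)%N.
Proof.
elim/ltn_ind: d a s => d IH a s dom.
have [d3|d3] := ltnP d 3.
  case: d d3 dom {IH} => [|d] d3 dom; first by [].
  have : has (near a) s by apply: dom; lia.
  by case: s {dom} => // x s _; rewrite /square_path_gamma /=; lia.
have [x [y [xs ys xy xa ya]]] := two_early_dominators d3 dom.
have yrem : y \in rem x s.
  have := perm_mem (perm_to_rem xs) y.
  by rewrite ys inE eq_sym (negPf xy) /= => <-.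
have s_perm : perm_eq s (x :: y :: rem y (rem x s)).
  by apply: perm_trans (perm_to_rem xs) _; rewrite perm_cons perm_to_rem.
rewrite (perm_size s_perm) square_path_gamma_sub7 // !ltnS.
apply: (IH _ _ (a + 7)%N) => [|p p_in]; first by lia.
have : has (near p) s by apply: dom; lia.
rewrite (perm_has _ s_perm) /= => /or3P[] // contra.
all: by exfalso; move: contra p_in; rewrite /near; lia.
Qed.

Lemma square_path_dominated d : (3 <= d)%N ->
  exists s : seq nat,
    [/\ all (fun q => q < d) s, size s = square_path_gamma d
      & forall p, p < d -> has (near p) s]%N.
Proof.
elim/ltn_ind: d => d IH d3.
have [d10|d10] := ltnP d 10; last first.
  have [||s [/allP s_lt s_size dom]] := IH (d - 7)%N; [lia|lia|].
  exists [:: 2, 4 & map (addn 7) s]%N; split=> /=.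
  - rewrite all_map; apply/and3P; split; [lia|lia|].
    by apply/allP => q /s_lt /=; lia.
  - by rewrite size_map s_size -square_path_gamma_sub7.
  - move=> p pd; have [p7|p7] := ltnP p 7.
      have p24 : near p 2 || near p 4 by rewrite /near; lia.
      by rewrite orbA p24.
    have /hasP[q qs pq] : has (near (p - 7)) s by apply: dom; lia.
    apply/orP; right; apply/orP; right.
    apply/hasP; exists (7 + q)%N; first exact: map_f.
    by move: pq; rewrite /near; lia.
(* For short intervals the pair must stay inside; one more element extends
   the reach of 2 and 4 from seven to nine positions. *)
pose s := (if d <= 5 then [:: 1; 2] else
           if d <= 7 then [:: 2; 4] else [:: 2; 4; 6])%N.
have [s_lt s_size s_dom] : [/\ all (fun q => q < d)%N s,
    size s = square_path_gamma d & all (fun p => has (near p) s) (iota 0 d)].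
  by rewrite /s; move: d3 d10 {IH s}; do 10 (case: d => [|d] //).
by exists s; split=> // p pd; apply: (allP s_dom); rewrite mem_iota.
Qed.

(** * Positions of the vertices and edges of a path *)

(** Twice the abscissa of a vertex, or of the midpoint of an edge: the edge
    joining [i] and [i+1] lies at [i + (i+1)], between [2i] and [2(i+1)]. *)
Definition pos n (x : mixed (path_graph n)) : nat :=
  match x with
  | inl i => (nat_of_ord i).*2
  | inr a => \sum_(i in val a) nat_of_ord i
  end%N.

Lemma path_edgeP n (a : {set 'I_n}) :
  reflect (exists i j : 'I_n, nat_of_ord j = i.+1 /\ a = [set i; j])
          (a \in edges (path_graph n)).
Proof.
apply: (iffP imset2P) => [[i j _]|[i [j [ij ->]]]].
  rewrite !inE /= => /orP[]/eqP ij ->; first by exists i, j.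
  by exists j, i; rewrite setUC.
by exists i j; rewrite ?inE //= /path_adj ij eqxx.
Qed.

Lemma sum_path_edge n (i j : 'I_n) : nat_of_ord j = i.+1 ->
  (\sum_(k in [set i; j]) nat_of_ord k = i.*2.+1)%N.
Proof.
move=> ij; rewrite big_setU1 ?big_set1 /=; first by lia.
by rewrite inE; apply/eqP => eq_ij; move: ij; rewrite -eq_ij; lia.
Qed.

Lemma pos_inj n : injective (@pos n).
Proof.
case=> [i|[a aE]] [j|[b bE]] /=.
- by move=> ij; congr inl; apply: val_inj => /=; lia.
- case/path_edgeP: (bE) => k [l [kl def_b]] eq_pos; exfalso; move: eq_pos.
  by rewrite def_b sum_path_edge //; lia.
- case/path_edgeP: (aE) => k [l [kl def_a]] eq_pos; exfalso; move: eq_pos.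
  by rewrite def_a sum_path_edge //; lia.
have /path_edgeP[i [j [ij def_a]]] := aE.
have /path_edgeP[k [l [kl def_b]]] := bE.
move=> eq_pos; have ik : i.*2.+1 = k.*2.+1.
  by rewrite -(sum_path_edge ij) -(sum_path_edge kl) -def_a -def_b.
congr inr; apply: val_inj => /=; rewrite def_a def_b.
by congr [set _; _]; apply: val_inj => /=; lia.
Qed.

Lemma pos_surj n p : (p < n.*2.-1)%N -> exists x, @pos n x = p.
Proof.
move=> pn; have lt_in : (p./2 < n)%N by lia.
case p_odd: (odd p); last first.
  by exists (inl (Ordinal lt_in)) => /=; lia.
have lt_jn : (p./2.+1 < n)%N by lia.
have aE : [set Ordinal lt_in; Ordinal lt_jn] \in edges (path_graph n).
  by apply/path_edgeP; exists (Ordinal lt_in), (Ordinal lt_jn).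
exists (inr (exist (fun a => a \in edges (path_graph n)) _ aE)).
by rewrite /= sum_path_edge //=; lia.
Qed.

Lemma pos_lt n (x : mixed (path_graph n)) : (pos x < n.*2.-1)%N.
Proof.
case: x => [i|[a aE]] /=; first by have := ltn_ord i; lia.
case/path_edgeP: (aE) => k [l [kl ->]]; rewrite sum_path_edge //.
by have := ltn_ord l; lia.
Qed.

Lemma path_edges_meet n (i j k l : 'I_n) :
  nat_of_ord j = i.+1 -> nat_of_ord l = k.+1 ->
  ([set i; j] :&: [set k; l] != set0) = (i <= k.+1)%N && (k <= i.+1)%N.
Proof.
move=> ij kl; apply/set0Pn/andP => [[x]|[ik ki]].
  by rewrite !inE -!val_eqE /=; lia.
have [lt_ik|le_ki] := ltnP i k.
  by exists j; rewrite !inE -!val_eqE /=; lia.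
by exists i; rewrite !inE -!val_eqE /=; lia.
Qed.

Lemma mixed_adj_pos n (x y : mixed (path_graph n)) :
  mixed_adj x y = near (pos x) (pos y).
Proof.
case: x y => [i|a] [j|b].
- by rewrite /= /path_adj /near; lia.
- case: b => b bE /=; case/path_edgeP: (bE) => k [l [kl ->]].
  by rewrite sum_path_edge // /near !inE -!val_eqE /=; lia.
- case: a => a aE /=; case/path_edgeP: (aE) => k [l [kl ->]].
  by rewrite sum_path_edge // /near !inE -!val_eqE /=; lia.
rewrite [LHS]/= /near (inj_eq (@pos_inj n)); congr (_ && _).
case: a b => [a aE] [b bE] /=.
have /path_edgeP[i [j [ij ->]]] := aE.
have /path_edgeP[k [l [kl ->]]] := bE.
by rewrite path_edges_meet // !sum_path_edge //; lia.
Qed.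

(** * The total mixed domination number of a path *)

Lemma gamma_tm_path n : (2 <= n)%N ->
  gamma_tm (path_graph n) = square_path_gamma n.*2.-1.
Proof.
move=> n2.
have [[S domS <-] minS] := gamma_tmP (path_graph_min_degree_ge1 n2).
apply/eqP; rewrite eqn_leq; apply/andP; split.
  have [|s [s_lt <- dom]] := @square_path_dominated n.*2.-1; first by lia.
  pose T := [set x : mixed (path_graph n) | pos x \in s].
  have cardT : (#|T| <= size s)%N.
    rewrite cardE -(size_map (@pos n)); apply: uniq_leq_size.
      by rewrite (map_inj_uniq (@pos_inj n)) enum_uniq.
    by move=> q /mapP[x]; rewrite mem_enum inE => xs ->.
  have domT : total_mixed_dominating T.
    apply/forallP => x; apply/existsP.
    have /hasP[q qs xq] := dom _ (pos_lt x).
    have [y def_q] := pos_surj (allP s_lt q qs).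
    by exists y; rewrite inE def_q qs mixed_adj_pos def_q.
  by apply: leq_trans cardT; move: (minS T domT).
rewrite cardE -(size_map (@pos n)).
apply: (square_path_gamma_le (a := 0)) => p p_lt.
have [|x def_p] := @pos_surj n p; first by lia.
have /forallP/(_ x)/existsP[y /andP[yS xy]] := domS.
apply/hasP; exists (pos y); first by rewrite map_f ?mem_enum.
by rewrite -def_p -mixed_adj_pos.
Qed.

Lemma ceil_div7 (n : nat) :
  Num.ceil (n%:R / 7 : rat) = ((n + 6) %/ 7)%N%:Z.
Proof.
set q := ((n + 6) %/ 7)%N.
have q_lo : (7 * q <= n + 6)%N by rewrite /q; lia.
have q_hi : (n <= 7 * q)%N by rewrite /q; lia.
have lo : (7 * q)%:R <= (n + 6)%:R :> rat by rewrite ler_nat.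
have hi : n%:R <= (7 * q)%:R :> rat by rewrite ler_nat.
rewrite natrM natrD in lo; rewrite natrM in hi.
apply: ceil_def; rewrite intrB -!pmulrn; apply/andP; split; lra.
Qed.

Theorem proposition3p1 (n : nat) (hn : (2 <= n)%N) :
  [/\ (n %% 7 = 1)%N ->
        (gamma_tm (path_graph n))%:Z = 4 * Num.ceil (n%:R / 7 : rat) - 3,
      (n %% 7 \in [:: 2; 3; 4])%N ->
        (gamma_tm (path_graph n))%:Z = 4 * Num.ceil (n%:R / 7 : rat) - 2,
      (n %% 7 = 5)%N ->
        (gamma_tm (path_graph n))%:Z = 4 * Num.ceil (n%:R / 7 : rat) - 1
    & (n %% 7 \in [:: 0; 6])%N ->
        (gamma_tm (path_graph n))%:Z = 4 * Num.ceil (n%:R / 7 : rat)].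
Proof.
rewrite gamma_tm_path // ceil_div7 /square_path_gamma.
by split; rewrite ?inE; lia.
Qed.
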